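(* Let $\mathcal{A}(p;q)$ and $\mathcal{B}(p;q)$ be the algebras over the field $\mathbb{K}$ of characteristic $0$ defined in the context, where $q\in\mathbb{K}\setminus\{0\}$ and $p$ is a polynomial in one variable over $\mathbb{K}$, and let $z:=z_+z_-\in\mathcal{A}(p;q)$. Consider the linear maps $\sigma_+,\sigma_-,\sigma_0$ of $\mathcal{A}(p;q)$ defined on homogeneous elements $a\in \mathcal{A}(p;q)$ of degree $|a|$ by $$\sigma_\pm(a)=q^{|a|}a,\qquad \sigma_0(a)=q^{2|a|}a,$$ and the polynomial $$c(z):=q\,p_{q^2}(z)=q\,\frac{p(q^2z)-p(z)}{(q^2-1)z}.$$ Then: (1) The maps $\sigma_\pm$, $\sigma_0$ are algebra automorphisms of $\mathcal{A}(p;q)$. (2) For all $\alpha_0\in\mathbb{K}$, the map $\partial_0$ defined on the generators of $\mathcal{A}(p;q)$ by $$\partial_0(x_+)=\alpha_0x_+,\quad \partial_0(x_-)=-q^{-2}\alpha_0x_-,\quad \partial_0(z_+)=\alpha_0z_+,\quad \partial_0(z_-)=-q^{-2}\alpha_0z_-$$ extends to the whole of $\mathcal{A}(p;q)$ as a skew $\sigma_0$-derivation. (3) For all $\alpha_-\in\mathbb{K}$, the map $\partial_-$ defined on the generators by $$\partial_-(x_+)=\partial_-(z_+)=0,\quad \partial_-(x_-)=\alpha_-c(z)z_+,\quad \partial_-(z_-)=\alpha_-x_+$$ extends to the whole of $\mathcal{A}(p;q)$ as a skew $\sigma_-$-derivation. (4) For all $\alpha_+\in\mathbb{K}$, the map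 $\partial_+$ defined on the generators by $$\partial_+(x_-)=\partial_+(z_-)=0,\quad \partial_+(x_+)=\alpha_+c(z)z_-,\quad \partial_+(z_+)=\alpha_+x_-$$ extends to the whole of $\mathcal{A}(p;q)$ as a skew $\sigma_+$-derivation. (5) The maps $\partial_0,\partial_\pm$ are $q$-skew derivations, i.e. $$\sigma_0^{-1}\circ\partial_0\circ\sigma_0=\partial_0,\qquad \sigma_+^{-1}\circ\partial_+\circ\sigma_+=q^{2}\partial_+,\qquad \sigma_-^{-1}\circ\partial_-\circ\sigma_-=q^{-2}\partial_-.$$ (6) The maps $\delta_+:=\partial_+\circ\Theta$ and $\delta_-:=\partial_-\circ\Theta$ on $\mathcal{B}(p;q)$ take values in $\mathcal{A}(p;q)_{-2}$ and $\mathcal{A}(p;q)_{2}$ respectively, and are derivations with values in these $\mathcal{B}(p;q)$-bimodules, while $\partial_0\circ\Theta=0$.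
   Context: All algebras are associative and unital over a field $\mathbb{K}$ of characteristic $0$; $q\in\mathbb{K}$, $q\ne0$, and $p$ is a polynomial in one variable over $\mathbb{K}$. For a polynomial $p$, $p_{q^2}(z):=\frac{p(q^2z)-p(z)}{(q^2-1)z}$ is its $q^2$-derivative, understood as the usual formal derivative $p'(z)$ when $q^2=1$. $\mathcal{A}(p;q)$ is the algebra generated by $x_+,x_-,z_+,z_-$ subject to the relations $$z_+z_-=z_-z_+,\quad x_+z_\pm=q^{-1}z_\pm x_+,\quad x_-z_\pm=q z_\pm x_-,\quad x_+x_-=p(z_+z_-),\quad x_-x_+=p(q^2z_-z_+).$$ It is $\mathbb{Z}$-graded by $|z_\pm|=|x_\pm|=\pm1$; $\mathcal{A}(p;q)_k$ denotes the degree-$k$ component. $\mathcal{B}(p;q)$ is the algebra generated by $x,y,z$ subject to the relations $xz=q^2zx$, $yz=q^{-2}zy$, $xy=q^2zp(q^2z)$, $yx=zp(z)$. The map $\Theta:\mathcal{B}(p;q)\to\mathcal{A}(p;q)_0$, $x\mapsto x_-z_+$, $y\mapsto z_-x_+$, $z\mapsto z_-z_+$, is an algebra isomorphism; through it each $\mathcal{A}(p;q)_k$ is a $\mathcal{B}(p;q)$-bimodule. For an algebra $\mathcal{A}$ and an algebra automorphism $\sigma$ of $\mathcal{A}$, a (right) skew $\sigma$-derivation is a linear map $\partial:\mathcal{A}\to\mathcal{A}$ with $\partial(ab)=\partial(a)\sigma(b)+a\partial(b)$ for all $a,b\in\mathcal{A}$. For a bimodule $M$ over an algebra $\mathcal{B}$,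 an $M$-valued derivation is a linear map $\delta:\mathcal{B}\to M$ with $\delta(ab)=\delta(a)b+a\delta(b)$. *)

(* Defs.v *)
From HB Require Import structures.
From mathcomp Require Import all_boot all_order all_algebra.
From mathcomp Require Import generic_quotient.
From mathcomp Require Import boolp.

Set Implicit Arguments.
Unset Strict Implicit.
Unset Printing Implicit Defensive.

Import GRing.Theory.
Local Open Scope ring_scope.
Local Open Scope quotient_scope.

(** [presalg R] is the algebra of formal expressions in the generators [G],
    modulo the least congruence that contains the relations [R] and makes the
    quotient an associative unital [K]-algebra. *)

Inductive term (K G : Type) : Type :=
| Gen of G
| Cst of K
| Add of term K G & term K G
| Mul of term K G & term K G.

Arguments Gen {K G} g.
Arguments Cst {K G} k.
Arguments Add {K G} s t.
Arguments Mul {K G} s t.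

HB.instance Definition _ (K G : Type) := gen_eqMixin (term K G).
HB.instance Definition _ (K G : Type) := gen_choiceMixin (term K G).

Section Presentation.
Variables (K : fieldType) (G : Type) (R : term K G -> term K G -> Prop).
Local Notation T := (term K G).

Inductive congr_rel : T -> T -> Prop :=
| cr_rel s t : R s t -> congr_rel s t
| cr_refl t : congr_rel t t
| cr_sym s t : congr_rel s t -> congr_rel t s
| cr_trans s t u : congr_rel s t -> congr_rel t u -> congr_rel s u
| cr_add s s' t t' : congr_rel s s' -> congr_rel t t' ->
    congr_rel (Add s t) (Add s' t')
| cr_mul s s' t t' : congr_rel s s' -> congr_rel t t' ->
    congr_rel (Mul s t) (Mul s' t')
| cr_addA s t u : congr_rel (Add s (Add t u)) (Add (Add s t) u)
| cr_addC s t : congr_rel (Add s t) (Add t s)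
| cr_add0 t : congr_rel (Add (Cst 0) t) t
| cr_addN t : congr_rel (Add (Mul (Cst (-1)) t) t) (Cst 0)
| cr_mulA s t u : congr_rel (Mul s (Mul t u)) (Mul (Mul s t) u)
| cr_mul1l t : congr_rel (Mul (Cst 1) t) t
| cr_mul1r t : congr_rel (Mul t (Cst 1)) t
| cr_mulDl s t u : congr_rel (Mul (Add s t) u) (Add (Mul s u) (Mul t u))
| cr_mulDr s t u : congr_rel (Mul s (Add t u)) (Add (Mul s t) (Mul s u))
| cr_cstD a b : congr_rel (Cst (a + b)) (Add (Cst a) (Cst b))
| cr_cstM a b : congr_rel (Cst (a * b)) (Mul (Cst a) (Cst b))
| cr_cstC a t : congr_rel (Mul (Cst a) t) (Mul t (Cst a)).

Definition congrb (s t : T) : bool := `[< congr_rel s t >].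

Lemma congrb_refl : reflexive congrb.
Proof. by move=> t; apply/asboolP; exact: cr_refl. Qed.

Lemma congrb_sym : symmetric congrb.
Proof. by move=> s t; apply/asboolP/asboolP => /cr_sym. Qed.

Lemma congrb_trans : transitive congrb.
Proof.
by move=> t s u /asboolP st /asboolP tu; apply/asboolP; exact: cr_trans st tu.
Qed.

Canonical congr_equiv := EquivRel congrb congrb_refl congrb_sym congrb_trans.

Definition presalg := {eq_quot congr_equiv}.

HB.instance Definition _ := Choice.on presalg.
HB.instance Definition _ := EqQuotient.on presalg.

Definition cls (t : T) : presalg := \pi_presalg t.

Lemma clsP s t : cls s = cls t <-> congr_rel s t.
Proof.
by split=> [/eqquotP/asboolP | st] //; apply/eqquotP/asboolP.
Qed.

Lemma cls_ind (P : presalg -> Prop) : (forall t, P (cls t)) -> forall a, P a.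
Proof. by move=> Pt a; rewrite -[a]reprK; exact: Pt. Qed.

Lemma congr_repr t : congr_rel (repr (cls t)) t.
Proof. by apply/clsP; exact: reprK. Qed.

Definition pa_zero : presalg := cls (Cst 0).
Definition pa_one : presalg := cls (Cst 1).
Definition pa_add (a b : presalg) : presalg := cls (Add (repr a) (repr b)).
Definition pa_mul (a b : presalg) : presalg := cls (Mul (repr a) (repr b)).
Definition pa_opp (a : presalg) : presalg := cls (Mul (Cst (-1)) (repr a)).
Definition pa_scale (k : K) (a : presalg) : presalg :=
  cls (Mul (Cst k) (repr a)).

Lemma pa_addE s t : pa_add (cls s) (cls t) = cls (Add s t).
Proof. by apply/clsP; apply: cr_add; exact: congr_repr. Qed.

Lemma pa_mulE s t : pa_mul (cls s) (cls t) = cls (Mul s t).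
Proof. by apply/clsP; apply: cr_mul; exact: congr_repr. Qed.

Lemma pa_oppE t : pa_opp (cls t) = cls (Mul (Cst (-1)) t).
Proof. by apply/clsP; apply: cr_mul; [exact: cr_refl | exact: congr_repr]. Qed.

Lemma pa_scaleE k t : pa_scale k (cls t) = cls (Mul (Cst k) t).
Proof. by apply/clsP; apply: cr_mul; [exact: cr_refl | exact: congr_repr]. Qed.

Fact pa_addA : associative pa_add.
Proof.
elim/cls_ind=> s; elim/cls_ind=> t; elim/cls_ind=> u.
by rewrite !pa_addE; apply/clsP; exact: cr_addA.
Qed.

Fact pa_addC : commutative pa_add.
Proof.
elim/cls_ind=> s; elim/cls_ind=> t.
by rewrite !pa_addE; apply/clsP; exact: cr_addC.
Qed.

Fact pa_add0 : left_id pa_zero pa_add.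
Proof. by elim/cls_ind=> t; rewrite pa_addE; apply/clsP; exact: cr_add0. Qed.

Fact pa_addN : left_inverse pa_zero pa_opp pa_add.
Proof.
by elim/cls_ind=> t; rewrite pa_oppE pa_addE; apply/clsP; exact: cr_addN.
Qed.

HB.instance Definition _ :=
  GRing.isZmodule.Build presalg pa_addA pa_addC pa_add0 pa_addN.

Fact pa_mulA : associative pa_mul.
Proof.
elim/cls_ind=> s; elim/cls_ind=> t; elim/cls_ind=> u.
by rewrite !pa_mulE; apply/clsP; exact: cr_mulA.
Qed.

Fact pa_mul1l : left_id pa_one pa_mul.
Proof. by elim/cls_ind=> t; rewrite pa_mulE; apply/clsP; exact: cr_mul1l. Qed.

Fact pa_mul1r : right_id pa_one pa_mul.
Proof. by elim/cls_ind=> t; rewrite pa_mulE; apply/clsP; exact: cr_mul1r. Qed.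

Fact pa_mulDl : left_distributive pa_mul +%R.
Proof.
elim/cls_ind=> s; elim/cls_ind=> t; elim/cls_ind=> u.
by rewrite /GRing.add /= !(pa_addE, pa_mulE); apply/clsP; exact: cr_mulDl.
Qed.

Fact pa_mulDr : right_distributive pa_mul +%R.
Proof.
elim/cls_ind=> s; elim/cls_ind=> t; elim/cls_ind=> u.
by rewrite /GRing.add /= !(pa_addE, pa_mulE); apply/clsP; exact: cr_mulDr.
Qed.

HB.instance Definition _ := GRing.Zmodule_isPzRing.Build presalg
  pa_mulA pa_mul1l pa_mul1r pa_mulDl pa_mulDr.

Fact pa_scaleA a b (v : presalg) :
  pa_scale a (pa_scale b v) = pa_scale (a * b) v.
Proof.
elim/cls_ind: v => t; rewrite !pa_scaleE; apply/clsP.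
apply: cr_trans (cr_mulA _ _ _) _; apply: cr_mul (cr_refl _).
by apply: cr_sym; exact: cr_cstM.
Qed.

Fact pa_scale1 : left_id 1 pa_scale.
Proof. by elim/cls_ind=> t; rewrite pa_scaleE; apply/clsP; exact: cr_mul1l. Qed.

Fact pa_scaleDr : right_distributive pa_scale +%R.
Proof.
move=> k; elim/cls_ind=> s; elim/cls_ind=> t.
rewrite /GRing.add /= !(pa_addE, pa_scaleE).
by apply/clsP; exact: cr_mulDr.
Qed.

Fact pa_scaleDl (v : presalg) : {morph pa_scale^~ v : a b / a + b}.
Proof.
move=> a b; elim/cls_ind: v => t.
rewrite [in RHS]/GRing.add /= !pa_scaleE pa_addE; apply/clsP.
apply: cr_trans (cr_mulDl _ _ _); apply: cr_mul (cr_refl _).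
exact: cr_cstD.
Qed.

HB.instance Definition _ := GRing.Zmodule_isLmodule.Build K presalg
  pa_scaleA pa_scale1 pa_scaleDr pa_scaleDl.

Lemma clsD s t : cls (Add s t) = cls s + cls t.
Proof. by rewrite -pa_addE. Qed.

Lemma clsM s t : cls (Mul s t) = cls s * cls t.
Proof. by rewrite -pa_mulE. Qed.

Lemma clsZ k t : cls (Mul (Cst k) t) = k *: cls t.
Proof. by rewrite -pa_scaleE. Qed.

Lemma clsC k : cls (Cst k) = k *: (1 : presalg).
Proof. by rewrite [1]/(cls (Cst 1)) -clsZ; apply/clsP/cr_sym/cr_mul1r. Qed.

Lemma cls_rel s t : R s t -> cls s = cls t.
Proof. by move=> st; apply/clsP; exact: cr_rel. Qed.

Fact presalg_scaleAl k (a b : presalg) : k *: (a * b) = (k *: a) * b.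
Proof.
elim/cls_ind: a => s; elim/cls_ind: b => t.
by rewrite -clsM -!clsZ -clsM; apply/clsP; exact: cr_mulA.
Qed.

Fact presalg_scaleAr k (a b : presalg) : k *: (a * b) = a * (k *: b).
Proof.
elim/cls_ind: a => s; elim/cls_ind: b => t.
rewrite -clsM -!clsZ -clsM; apply/clsP; apply: cr_trans (cr_mulA _ _ _) _.
apply: cr_trans (cr_sym (cr_mulA _ _ _)).
by apply: cr_mul (cr_refl _); exact: cr_cstC.
Qed.

Section Eval.
Variables (C : algType K) (v : G -> C).

Fixpoint eval (t : T) : C :=
  match t with
  | Gen g => v g
  | Cst k => k%:A
  | Add s u => eval s + eval u
  | Mul s u => eval s * eval u
  end.

Hypothesis vR : forall s t, R s t -> eval s = eval t.

Lemma eval_congr s t : congr_rel s t -> eval s = eval t.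
Proof.
elim=> //=.
- by move=> s' t' u' _ -> _ ->.
- by move=> s1 s2 t1 t2 _ -> _ ->.
- by move=> s1 s2 t1 t2 _ -> _ ->.
- by move=> *; rewrite addrA.
- by move=> *; rewrite addrC.
- by move=> *; rewrite scale0r add0r.
- by move=> *; rewrite scaleN1r mulN1r addNr scale0r.
- by move=> *; rewrite mulrA.
- by move=> *; rewrite scale1r mul1r.
- by move=> *; rewrite scale1r mulr1.
- by move=> *; rewrite mulrDl.
- by move=> *; rewrite mulrDr.
- by move=> *; rewrite scalerDl.
- by move=> *; rewrite -scalerAl mul1r scalerA.
- by move=> *; rewrite -scalerAl -scalerAr mul1r mulr1.
Qed.

Lemma presalg_neq0 : (1 : presalg) != 0.
Proof.
apply/eqP=> /clsP/eval_congr/eqP /=.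
by rewrite scale0r scale1r oner_eq0.
Qed.

End Eval.

End Presentation.

(** [presalg_lift hv] is the algebra morphism sending each generator [g]
    to [v g]. *)
Definition presalg_lift (K : fieldType) (G : Type)
    (R : term K G -> term K G -> Prop) (C : algType K) (v : G -> C)
    (hv : forall s t, R s t -> eval v s = eval v t) (a : presalg R) : C :=
  eval v (repr a).

Section Lift.
Variables (K : fieldType) (G : Type) (R : term K G -> term K G -> Prop).
Variables (C : algType K) (v : G -> C).
Hypothesis hv : forall s t, R s t -> eval v s = eval v t.

Lemma presalg_liftE t : presalg_lift hv (cls R t) = eval v t.
Proof. by apply: (eval_congr hv); exact: congr_repr. Qed.

Lemma presalg_lift_linear : linear (presalg_lift hv).
Proof.
move=> k; elim/cls_ind=> s; elim/cls_ind=> t.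
by rewrite -clsZ -clsD !presalg_liftE /= -scalerAl mul1r.
Qed.

Lemma presalg_liftM : {morph presalg_lift hv : a b / a * b}.
Proof.
elim/cls_ind=> s; elim/cls_ind=> t.
by rewrite -clsM !presalg_liftE.
Qed.

Lemma presalg_lift1 : presalg_lift hv 1 = 1.
Proof. by rewrite [1]/(cls R (Cst 1)) presalg_liftE /= scale1r. Qed.

End Lift.

(** The polynomial [p] evaluated at a formal expression, in Horner form. *)
Definition hornert (K : fieldType) (G : Type) (p : {poly K}) (t : term K G) :
    term K G :=
  foldr (fun c u => Add (Mul u t) (Cst c)) (Cst 0) p.

Lemma eval_hornert (K : fieldType) (G : Type) (C : algType K) (v : G -> C)
    (p : {poly K}) (t : term K G) :
  eval v (hornert p t) = horner_alg (eval v t) p.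
Proof.
rewrite -[p in RHS]polyseqK /hornert.
elim: (polyseq p) => [|c s IHs] /=; first by rewrite scale0r rmorph0.
by rewrite cons_poly_def rmorphD rmorphM /= horner_algC horner_algX IHs.
Qed.


Inductive agen := GXp | GXm | GZp | GZm.

Inductive Arel (K : fieldType) (p : {poly K}) (q : K) :
    term K agen -> term K agen -> Prop :=
| Arel_zz : Arel p q (Mul (Gen GZp) (Gen GZm)) (Mul (Gen GZm) (Gen GZp))
| Arel_xpzp : Arel p q (Mul (Gen GXp) (Gen GZp))
                       (Mul (Cst q^-1) (Mul (Gen GZp) (Gen GXp)))
| Arel_xpzm : Arel p q (Mul (Gen GXp) (Gen GZm))
                       (Mul (Cst q^-1) (Mul (Gen GZm) (Gen GXp)))
| Arel_xmzp : Arel p q (Mul (Gen GXm) (Gen GZp))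
                       (Mul (Cst q) (Mul (Gen GZp) (Gen GXm)))
| Arel_xmzm : Arel p q (Mul (Gen GXm) (Gen GZm))
                       (Mul (Cst q) (Mul (Gen GZm) (Gen GXm)))
| Arel_xpxm : Arel p q (Mul (Gen GXp) (Gen GXm))
                       (hornert p (Mul (Gen GZp) (Gen GZm)))
| Arel_xmxp : Arel p q (Mul (Gen GXm) (Gen GXp))
                (hornert p (Mul (Cst (q ^+ 2)) (Mul (Gen GZm) (Gen GZp)))).

Definition Apq (K : fieldType) (p : {poly K}) (q : K) := presalg (Arel p q).


Inductive bgen := GX | GY | GZ.

Inductive Brel (K : fieldType) (p : {poly K}) (q : K) :
    term K bgen -> term K bgen -> Prop :=
| Brel_xz : Brel p q (Mul (Gen GX) (Gen GZ))
                     (Mul (Cst (q ^+ 2)) (Mul (Gen GZ) (Gen GX)))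
| Brel_yz : Brel p q (Mul (Gen GY) (Gen GZ))
                     (Mul (Cst (q ^- 2)) (Mul (Gen GZ) (Gen GY)))
| Brel_xy : Brel p q (Mul (Gen GX) (Gen GY))
                     (Mul (Mul (Cst (q ^+ 2)) (Gen GZ))
                          (hornert p (Mul (Cst (q ^+ 2)) (Gen GZ))))
| Brel_yx : Brel p q (Mul (Gen GY) (Gen GX))
                     (Mul (Gen GZ) (hornert p (Gen GZ))).

Definition Bpq (K : fieldType) (p : {poly K}) (q : K) := presalg (Brel p q).

Section Algebras.
Variables (K : fieldType) (p : {poly K}) (q : K).
Local Notation A := (Apq p q).
Local Notation B := (Bpq p q).

(* Both algebras are nonzero: they have a character, given by x_+ |-> 1,
   x_- |-> p(0), z_+, z_- |-> 0, respectively x, y, z |-> 0. *)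
Fact Apq_neq0 : (1 : A) != 0.
Proof.
pose v (g : agen) : K^o :=
  match g with GXp => 1 | GXm => p.[0] | _ => 0 end.
have E r : horner_alg (0 : K^o) r = r.[0].
  elim/poly_ind: r => [|r c _]; first by rewrite rmorph0 horner0.
  by rewrite rmorphD rmorphM /= horner_algC horner_algX hornerMXaddC !mulr0
             !add0r [_ *: _]mulr1.
apply: (@presalg_neq0 _ _ _ K^o v) => s t [] /=;
  rewrite ?eval_hornert /= ?(mulr0, mul0r, mul1r, mulr1) ?E //.
Qed.

Fact Bpq_neq0 : (1 : B) != 0.
Proof.
apply: (@presalg_neq0 _ _ _ K^o (fun _ => 0)) => s t [] /=;
  by rewrite ?(mulr0, mul0r).
Qed.

HB.instance Definition _ := GRing.PzRing.on A.
HB.instance Definition _ := GRing.Lmodule.on A.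
HB.instance Definition _ := GRing.PzSemiRing_isNonZero.Build A Apq_neq0.
HB.instance Definition _ := GRing.Lmodule_isLalgebra.Build K A
  (@presalg_scaleAl _ _ (Arel p q)).
HB.instance Definition _ := GRing.Lalgebra_isAlgebra.Build K A
  (@presalg_scaleAr _ _ (Arel p q)).

HB.instance Definition _ := GRing.PzRing.on B.
HB.instance Definition _ := GRing.Lmodule.on B.
HB.instance Definition _ := GRing.PzSemiRing_isNonZero.Build B Bpq_neq0.
HB.instance Definition _ := GRing.Lmodule_isLalgebra.Build K B
  (@presalg_scaleAl _ _ (Brel p q)).
HB.instance Definition _ := GRing.Lalgebra_isAlgebra.Build K B
  (@presalg_scaleAr _ _ (Brel p q)).

Definition ag (g : agen) : A := cls (Arel p q) (Gen g).
Definition xp : A := ag GXp.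
Definition xm : A := ag GXm.
Definition zp : A := ag GZp.
Definition zm : A := ag GZm.

Definition bg (g : bgen) : B := cls (Brel p q) (Gen g).
Definition bX : B := bg GX.
Definition bY : B := bg GY.
Definition bZ : B := bg GZ.

Lemma cls_evalA t : cls (Arel p q) t = eval ag t.
Proof.
elim: t => //= [k|s <- t <-|s <- t <-].
- exact: clsC.
- exact: clsD.
- exact: clsM.
Qed.

Lemma A_rel s t : Arel p q s t -> eval ag s = eval ag t.
Proof. by move=> /cls_rel; rewrite !cls_evalA. Qed.

Lemma A_zz : zp * zm = zm * zp.
Proof. exact: (A_rel (Arel_zz p q)). Qed.

Lemma A_xpzp : xp * zp = q^-1 *: (zp * xp).
Proof. by have /= := A_rel (Arel_xpzp p q); rewrite -scalerAl mul1r. Qed.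

Lemma A_xpzm : xp * zm = q^-1 *: (zm * xp).
Proof. by have /= := A_rel (Arel_xpzm p q); rewrite -scalerAl mul1r. Qed.

Lemma A_xmzp : xm * zp = q *: (zp * xm).
Proof. by have /= := A_rel (Arel_xmzp p q); rewrite -scalerAl mul1r. Qed.

Lemma A_xmzm : xm * zm = q *: (zm * xm).
Proof. by have /= := A_rel (Arel_xmzm p q); rewrite -scalerAl mul1r. Qed.

Lemma A_xpxm : xp * xm = horner_alg (zp * zm) p.
Proof. by have /= := A_rel (Arel_xpxm p q); rewrite eval_hornert. Qed.

Lemma A_xmxp : xm * xp = horner_alg (q ^+ 2 *: (zm * zp)) p.
Proof.
by have /= := A_rel (Arel_xmxp p q); rewrite eval_hornert /= -scalerAl mul1r.
Qed.

(** [homog k a] : [a] belongs to the degree-[k] component A(p;q)_k, the linear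
    span of the words of degree [k] in the generators. *)
Definition adeg (g : agen) : int :=
  match g with GXp | GZp => 1 | GXm | GZm => -1 end.

Definition homog (k : int) (a : A) : Prop :=
  exists s : seq (K * seq agen),
    all (fun w => \sum_(g <- w.2) adeg g == k) s /\
    a = \sum_(w <- s) w.1 *: \prod_(g <- w.2) ag g.

Definition theta_gen (g : bgen) : A :=
  match g with GX => xm * zp | GY => zm * xp | GZ => zm * zp end.

Fact theta_rel s t : Brel p q s t -> eval theta_gen s = eval theta_gen t.
Proof.
have C r (u w : A) : u * w = w * u ->
    u * horner_alg w r = horner_alg w r * u.
  move=> uw; elim/poly_ind: r => [|r c IH]; first by rewrite rmorph0 mulr0 mul0r.
  rewrite rmorphD rmorphM /= horner_algC horner_algX mulrDr mulrDl.
  by rewrite mulrA IH -!mulrA uw -scalerAr -scalerAl mulr1 mul1r.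
have zpC : zp * (zm * zp) = zm * zp * zp by rewrite mulrA A_zz.
have zmC : zm * (zm * zp) = zm * zp * zm by rewrite -A_zz mulrA A_zz.
case=> /=; rewrite ?eval_hornert /= -?scalerAl ?mul1r.
- rewrite !mulrA -(mulrA xm zp zm) A_zz mulrA A_xmzm -!scalerAl.
  by rewrite -(mulrA zm xm zp) A_xmzp -scalerAr -scalerAl scalerA !mulrA.
- rewrite !mulrA -(mulrA zm xp zm) A_xpzm -scalerAr -scalerAl.
  rewrite mulrA -(mulrA _ xp zp) A_xpzp -scalerAr scalerA.
  by rewrite -exprVn expr2 -(mulrA zm zp zm) A_zz !mulrA.
- rewrite -A_xmxp !mulrA -(mulrA xm zp zm) A_zz mulrA A_xmzm -!scalerAl.
  by rewrite -(mulrA zm xm zp) A_xmzp -scalerAr -scalerAl scalerA !mulrA.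
- by rewrite !mulrA -(mulrA zm xp xm) A_xpxm A_zz -!mulrA -C.
Qed.

Definition Theta : B -> A := presalg_lift theta_rel.

Lemma Theta_linear : linear Theta.
Proof. exact: presalg_lift_linear. Qed.

Lemma ThetaM : {morph Theta : a b / a * b}.
Proof. exact: presalg_liftM. Qed.

Lemma Theta1 : Theta 1 = 1.
Proof. exact: presalg_lift1. Qed.

Lemma Theta_x : Theta bX = xm * zp.
Proof. exact: presalg_liftE. Qed.

Lemma Theta_y : Theta bY = zm * xp.
Proof. exact: presalg_liftE. Qed.

Lemma Theta_z : Theta bZ = zm * zp.
Proof. exact: presalg_liftE. Qed.

End Algebras.

Arguments xp {K p q}.
Arguments xm {K p q}.
Arguments zp {K p q}.
Arguments zm {K p q}.
Arguments bX {K p q}.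
Arguments bY {K p q}.
Arguments bZ {K p q}.


(** The [Q]-derivative (p(Qz) - p(z)) / ((Q - 1) z); the division is exact. *)
Definition qderiv (K : fieldType) (Q : K) (p : {poly K}) : {poly K} :=
  if Q == 1 then p^`()
  else ((p \Po (Q *: 'X)) - p) %/ ((Q - 1) *: 'X).

Definition is_automorphism (K : fieldType) (A : algType K) (s : A -> A) :
    Prop :=
  [/\ linear s, s 1 = 1, {morph s : a b / a * b} & bijective s].

Definition skew_derivation (K : fieldType) (A : algType K) (s d : A -> A) :
    Prop :=
  linear d /\ forall a b, d (a * b) = d a * s b + a * d b.

(** s^-1 o d o s = Q d *)
Definition q_skew (K : fieldType) (A : algType K) (Q : K) (s d : A -> A) :
    Prop :=
  forall t : A -> A, cancel s t -> cancel t s ->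
  forall a, t (d (s a)) = Q *: d a.

Section Calculus.
Variables (K : fieldType) (p : {poly K}) (q : K).
Local Notation A := (Apq p q).
Local Notation B := (Bpq p q).

(** The linear map multiplying the elements of degree [k] by [r ^ k]. *)
Definition degree_scaling (r : K) (s : A -> A) : Prop :=
  linear s /\ forall (k : int) (a : A), homog k a -> s a = r ^ k *: a.

Definition cz : A := horner_alg (zp * zm) (q *: qderiv (q ^+ 2) p).

Definition is_del0 (s0 : A -> A) (alpha : K) (d : A -> A) : Prop :=
  skew_derivation s0 d /\
  [/\ d xp = alpha *: xp, d xm = (- q ^- 2 * alpha) *: xm,
      d zp = alpha *: zp & d zm = (- q ^- 2 * alpha) *: zm].

Definition is_delm (sm : A -> A) (alpha : K) (d : A -> A) : Prop :=
  skew_derivation sm d /\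
  [/\ d xp = 0, d zp = 0,
      d xm = alpha *: (cz * zp) & d zm = alpha *: xp].

Definition is_delp (sp : A -> A) (alpha : K) (d : A -> A) : Prop :=
  skew_derivation sp d /\
  [/\ d xm = 0, d zm = 0,
      d xp = alpha *: (cz * zm) & d zp = alpha *: xm].

(** Derivations of B(p;q) with values in the bimodule A(p;q)_k, on which
    B(p;q) acts on both sides through Theta. *)
Definition B_derivation (k : int) (delta : B -> A) : Prop :=
  [/\ linear delta, forall b, homog k (delta b) &
      forall a b, delta (a * b) = delta a * Theta b + Theta a * delta b].

End Calculus.

(* Main.v *)
Require Import Defs.
From HB Require Import structures.
From mathcomp Require Import all_boot all_order all_algebra.

Set Implicit Arguments.
Unset Strict Implicit.
Unset Printing Implicit Defensive.

Import GRing.Theory.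
Local Open Scope ring_scope.

(** A sigma-derivation of an algebra given by generators and relations may be
    prescribed freely on the generators: the twisted Leibniz rule extends it
    to formal expressions ([deval]), and the extension descends to the quotient
    as soon as it takes equal values on the two sides of each defining relation
    ([skew_derivation_extend]). So each of the three existence claims is a
    finite check on the seven relations of A(p;q).

    Of the five relations other than those for x_+ x_- and x_- x_+, all but
    one only require moving scalars around. The exception, x_- z_- = q z_- x_-
    for del_- and x_+ z_+ = q^-1 z_+ x_+ for del_+, has as its image the
    identity
      x_- x_+ + q^-1 c(z) z = x_+ x_- + q c(z) z    ([xmxp_cz]),
    that is p(q^2 z) - p(z) = (q - q^-1) c(z) z, the defining property of the
    q^2-derivative in c = q p_{q^2}.

    The relations for x_+ x_- and x_- x_+ involve the derivative of f(z). Here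
    z has degree 0, so sigma fixes it, and dz := del z satisfies
    dz z = Q z dz with Q = q^2 for del_+ and Q = q^-2 for del_-; hence
    del(f(z)) = f_Q(z) dz ([deval_hornert]), with f_Q the Q-derivative. For
    del_+ the two sides then match by the choice of c, for del_- because
    moreover p_{Q^-1}(Q z) = p_Q(z) ([qderivV_comp_scaleX]).
    For del_0 one has dz = 0.

    The remaining claims come from the grading. Every element is a sum of
    homogeneous ones ([homog_add_ind]), so a degree scaling is determined by
    its factor and is multiplicative; a skew derivation moving each generator
    by m degrees moves every degree by m ([skew_derivation_homog]), and
    conjugating it by the scaling with factor r multiplies it by r^-m. On the
    image of Theta, which has degree 0, sigma is the identity, so the skew
    derivations restrict to ordinary ones; del_0 kills the three generators
    there. *)

(** * The Q-derivative of polynomials *)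

Section QDerivative.
Variable K : fieldType.
Implicit Types (p : {poly K}) (Q : K).

Lemma coef_comp_scaleX Q p n : (p \Po (Q *: 'X))`_n = Q ^+ n * p`_n.
Proof.
rewrite comp_polyE coef_sum; under eq_bigr do
  rewrite exprZn !coefZ coefXn mulrA.
case: (ltnP n (size p)) => [lt_np | le_pn].
  rewrite (bigD1 (Ordinal lt_np)) //= eqxx mulr1 mulrC big1 ?addr0 // => i.
  by rewrite -(inj_eq val_inj) /= eq_sym => /negPf->; rewrite mulr0.
rewrite [p`_n]nth_default // mulr0 big1 // => i _.
by rewrite gtn_eqF ?mulr0 // (leq_trans (ltn_ord i)).
Qed.

(** The coefficients of [qderiv] are given by the Q-integers
    [n+1]_Q = 1 + Q + ... + Q^n whether or not Q = 1; all later properties of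
    [qderiv] rest on this formula, so that the case Q = 1 never returns. *)
Lemma coef_qderiv Q p n :
  (qderiv Q p)`_n = (\sum_(i < n.+1) Q ^+ i) * p`_n.+1.
Proof.
rewrite /qderiv; case: eqVneq => [-> | Q_neq1].
  under eq_bigr do rewrite expr1n.
  by rewrite coef_deriv sumr_const card_ord mulr_natl.
pose E := \poly_(i < size p) ((\sum_(j < i.+1) Q ^+ j) * p`_i.+1).
have divE : p \Po (Q *: 'X) - p = E * ((Q - 1) *: 'X).
  apply/polyP => i; rewrite coefB coef_comp_scaleX -scalerAr coefZ coefMX.
  case: i => [|i] /=; first by rewrite mul1r subrr mulr0.
  rewrite coef_poly; case: ltnP => [_ | le_pi].
    by rewrite mulrA -subrX1 mulrBl mul1r.
  by rewrite [p`__]nth_default ?mulr0 ?subrr // ltnW.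
have D_neq0 : (Q - 1) *: 'X != 0 :> {poly K}.
  by rewrite scaler_eq0 subr_eq0 negb_or Q_neq1 polyX_eq0.
rewrite divE mulpK // coef_poly; case: ltnP => // le_pn.
by rewrite [p`__]nth_default ?mulr0 // ltnW.
Qed.

Lemma comp_scaleX_qderiv Q p :
  p \Po (Q *: 'X) = p + (Q - 1) *: (qderiv Q p * 'X).
Proof.
apply/polyP => i; rewrite coef_comp_scaleX coefD coefZ coefMX.
case: i => [|i] /=.
  by rewrite mul1r mulr0 addr0.
by rewrite coef_qderiv mulrA -subrX1 mulrBl mul1r addrC subrK.
Qed.

Lemma qderiv0 Q : qderiv Q 0 = 0.
Proof. by apply/polyP => i; rewrite coef_qderiv !coef0 mulr0. Qed.

(** The twisted Leibniz rule for a product with 'X, in the form in which it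
    serves inductions along Horner's scheme. *)
Lemma qderiv_cons Q p c :
  qderiv Q (p * 'X + c%:P) = p + Q *: (qderiv Q p * 'X).
Proof.
have cE i : (p * 'X + c%:P)`_i.+1 = p`_i by rewrite coefD coefMX coefC addr0.
apply/polyP => i; rewrite coef_qderiv cE.
rewrite coefD coefZ coefMX; case: i => [|i] /=.
  by rewrite big_ord1 mul1r mulr0 addr0.
rewrite coef_qderiv mulrA mulr_sumr big_ord_recl mulrDl mul1r.
by congr (_ + _ * _); apply: eq_bigr => j _; rewrite -exprS.
Qed.

(** On coefficients this is Q^n [n+1]_{Q^-1} = [n+1]_Q. It reconciles the
    q^2-derivative in c with the q^-2-derivative that appears when polynomials
    in z are moved past x_+. *)
Lemma qderivV_comp_scaleX Q p : Q != 0 ->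
  qderiv Q^-1 p \Po (Q *: 'X) = qderiv Q p.
Proof.
move=> Q_neq0; apply/polyP => n.
rewrite coef_comp_scaleX !coef_qderiv mulrA; congr (_ * _).
rewrite mulr_sumr (reindex_inj rev_ord_inj) /=; apply: eq_bigr => i _.
have le_in : (i <= n)%N by rewrite -ltnS.
rewrite subSS -[n in Q ^+ n](subnK le_in) exprD exprVn.
by rewrite mulrAC mulfV ?mul1r // expf_neq0.
Qed.

End QDerivative.

Section PolynomialsInAlgebra.
Variables (K : fieldType) (C : algType K).
Implicit Types (f : {poly K}) (a b : C).

Lemma horner_alg_scale k a f :
  horner_alg (k *: a) f = horner_alg a (f \Po (k *: 'X)).
Proof.
elim/poly_ind: f => [|f c IHf]; first by rewrite comp_poly0 !rmorph0.
rewrite comp_polyD comp_polyM comp_polyX comp_polyC !rmorphD !rmorphM /=.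
by rewrite !horner_algC horner_algX linearZ /= horner_algX IHf -scalerAl mul1r.
Qed.

Lemma horner_alg_skew k a b f : b * a = k *: (a * b) ->
  b * horner_alg a f = horner_alg (k *: a) f * b.
Proof.
move=> ba; elim/poly_ind: f => [|f c IHf]; first by rewrite !rmorph0 mulr0 mul0r.
rewrite !rmorphD !rmorphM /= !horner_algC !horner_algX mulrDr mulrDl.
rewrite mulrA IHf -!mulrA ba -scalerAl; congr (_ + _).
by rewrite -scalerAr -scalerAl mulr1 mul1r.
Qed.
End PolynomialsInAlgebra.

(** * Twisted derivations of presented algebras *)

(** The maps d with d(s t) = d(s) v(t) + u(s) d(t), for two algebra morphisms
    u and v, correspond to the algebra morphisms into upper triangular matrices
    with diagonal (u, v) and corner d. Defining them directly on formal
    expressions avoids building that matrix algebra. *)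
Section TwistedDerivations.
Variables (K : fieldType) (G : Type) (C : algType K).
Variables u v d : G -> C.

Fixpoint deval (t : term K G) : C :=
  match t with
  | Gen g => d g
  | Cst k => 0
  | Add s t => deval s + deval t
  | Mul s t => deval s * eval v t + eval u s * deval t
  end.

(** The chain rule behind the whole construction: if v fixes the argument a
    and its derivative da satisfies da a = Q a da, moving all the factors da
    to the right in d(a^n) leaves [n]_Q a^(n-1) da. *)
Lemma deval_hornert Q (p : {poly K}) t :
    eval v t = eval u t ->
    deval t * eval u t = Q *: (eval u t * deval t) ->
  deval (hornert p t) = horner_alg (eval u t) (qderiv Q p) * deval t.
Proof.
move=> vt dt; rewrite /hornert -[in RHS](polyseqK p).
(* The induction runs over arbitrary lists, which need not be coefficient
   lists of polynomials: hence [Poly], and the values of u alongside. *)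
set h := foldr _ _; set a := eval u t in vt dt *.
suff [//] : deval (h p) = horner_alg a (qderiv Q (Poly p)) * deval t /\
            eval u (h p) = horner_alg a (Poly p).
elim: (polyseq p) => [|c s [IHd IHu]] /=.
  by rewrite qderiv0 !rmorph0 mul0r scale0r.
rewrite cons_poly_def qderiv_cons !rmorphD !rmorphM /= linearZ /= rmorphM /=.
rewrite horner_algC horner_algX IHd IHu vt addr0; split=> //.
rewrite mulrDl addrC; congr (_ + _).
by rewrite mulr_algl -!mulrA dt -scalerAl -scalerAr mulrA.
Qed.

Variable R : term K G -> term K G -> Prop.
Hypothesis uR : forall s t, R s t -> eval u s = eval u t.
Hypothesis vR : forall s t, R s t -> eval v s = eval v t.
Hypothesis dR : forall s t, R s t -> deval s = deval t.

Lemma deval_congr s t : congr_rel R s t -> deval s = deval t.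
Proof.
have uE := eval_congr uR; have vE := eval_congr vR.
elim=> //=.
- by move=> s' t' u' _ -> _ ->.
- by move=> s1 s2 t1 t2 _ -> _ ->.
- by move=> s1 s2 t1 t2 /uE-> -> /vE-> ->.
- by move=> *; rewrite addrA.
- by move=> *; rewrite addrC.
- by move=> *; rewrite add0r.
- by move=> *; rewrite mul0r add0r scaleN1r mulN1r addNr.
- by move=> *; rewrite mulrDl mulrDr !mulrA addrA.
- by move=> *; rewrite mul0r add0r scale1r mul1r.
- by move=> *; rewrite mulr0 addr0 scale1r mulr1.
- by move=> *; rewrite !mulrDl addrACA.
- by move=> *; rewrite !mulrDr addrACA.
- by move=> *; rewrite addr0.
- by move=> *; rewrite mulr0 mul0r addr0.
- by move=> *; rewrite mul0r add0r mulr0 addr0 -scalerAl -scalerAr mul1r mulr1.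
Qed.

Definition presalg_der (a : presalg R) : C := deval (repr a).

Lemma presalg_derE t : presalg_der (cls R t) = deval t.
Proof. by apply: deval_congr; exact: congr_repr. Qed.

Lemma presalg_der_linear : linear presalg_der.
Proof.
move=> k; elim/cls_ind=> s; elim/cls_ind=> t.
by rewrite -clsZ -clsD !presalg_derE /= -scalerAl mul0r mul1r add0r.
Qed.

Lemma presalg_derM a b :
  presalg_der (a * b) =
  presalg_der a * presalg_lift vR b + presalg_lift uR a * presalg_der b.
Proof.
elim/cls_ind: a => s; elim/cls_ind: b => t.
by rewrite -clsM !presalg_derE !presalg_liftE.
Qed.
End TwistedDerivations.

(** * The grading of A(p;q) *)

Section LinearFunctions.
Variables (K : fieldType) (U V : lmodType K) (f : U -> V).
Hypothesis f_lin : linear f.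

Lemma linear_fun0 : f 0 = 0.
Proof. by have := f_lin (-1) 0 0; rewrite scaler0 addr0 scaleN1r addNr. Qed.

Lemma linear_funD a b : f (a + b) = f a + f b.
Proof. by have := f_lin 1 a b; rewrite !scale1r. Qed.

Lemma linear_funZ k a : f (k *: a) = k *: f a.
Proof. by have := f_lin k a 0; rewrite linear_fun0 !addr0. Qed.

End LinearFunctions.

Section Grading.
Variables (K : fieldType) (p : {poly K}) (q : K).
Local Notation A := (Apq p q).
Local Notation B := (Bpq p q).
Local Notation ag := (ag p q).
Implicit Types (a b : A) (k l m : int) (w : seq agen).

Local Notation word w := (\prod_(g <- w) ag g).
Local Notation wdeg w := (\sum_(g <- w) adeg g).

Lemma homog_ind k (P : A -> Prop) :
    P 0 -> (forall c a b, P a -> P b -> P (c *: a + b)) ->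
    (forall w, wdeg w = k -> P (word w)) ->
  forall a, homog k a -> P a.
Proof.
move=> P0 Pl Pw a [s [s_k ->]]; elim: s s_k => [|w s IHs] /=.
  by rewrite big_nil.
by case/andP=> /eqP wk /IHs Ps; rewrite big_cons; apply: Pl => //; exact: Pw.
Qed.

Lemma homog_word w : homog (wdeg w) (word w).
Proof. by exists [:: (1, w)]; rewrite /= eqxx big_seq1 scale1r. Qed.

Lemma homog0 k : homog k (0 : A).
Proof. by exists [::]; rewrite big_nil. Qed.

Lemma homogD k a b : homog k a -> homog k b -> homog k (a + b).
Proof.
move=> [s [sk ->]] [t [tk ->]]; exists (s ++ t).
by rewrite all_cat sk tk big_cat.
Qed.

Lemma homogZ k c a : homog k a -> homog k (c *: a).
Proof.
move=> [s [sk ->]]; exists [seq (c * w.1, w.2) | w : K * seq agen <- s].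
by rewrite all_map big_map scaler_sumr; split=> //;
  apply: eq_bigr => w _; rewrite scalerA.
Qed.

Lemma homogM k l a b : homog k a -> homog l b -> homog (k + l) (a * b).
Proof.
move=> ka lb; elim/homog_ind: a / ka => [|c a a' IHa IHa'|w <-].
- by rewrite mul0r; exact: homog0.
- by rewrite mulrDl -scalerAl; apply: homogD => //; exact: homogZ.
elim/homog_ind: b / lb => [|c b b' IHb IHb'|w' <-].
- by rewrite mulr0; exact: homog0.
- by rewrite mulrDr -scalerAr; apply: homogD => //; exact: homogZ.
by rewrite -!big_cat; exact: homog_word.
Qed.

Lemma homog_gen g : homog (adeg g) (ag g).
Proof. by have := homog_word [:: g]; rewrite !big_seq1. Qed.

Lemma homog1 : homog 0 (1 : A).
Proof. by have := homog_word [::]; rewrite !big_nil. Qed.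

Lemma homog_horner_alg a f : homog 0 a -> homog 0 (horner_alg a f).
Proof.
move=> a0; elim/poly_ind: f => [|f c IHf]; first by rewrite rmorph0; exact: homog0.
rewrite rmorphD rmorphM /= horner_algC horner_algX; apply: homogD.
  by rewrite -[0]addr0; exact: homogM.
by apply: homogZ; exact: homog1.
Qed.

(** The homogeneous components span A(p;q). *)
Lemma homog_add_ind (P : A -> Prop) :
    (forall a b, P a -> P b -> P (a + b)) ->
    (forall k a, homog k a -> P a) ->
  forall a, P a.
Proof.
move=> PD Ph; elim/cls_ind => t.
(* Generalizing the 1 in t * 1 to any homogeneous b, and P with it, makes the
   product (s * t) * b an instance of the hypothesis for t with predicate
   b' |-> P (s * b'). *)
rewrite -[cls _ t](mulr1 (cls (Arel p q) t : A)).
elim: t P PD Ph 0 1 homog1 => [g|c|s IHs t IHt|s IHs t IHt] P PD Ph k b kb.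
- by apply: (Ph (adeg g + k)); apply: homogM kb; exact: homog_gen.
- by apply: (Ph k); rewrite clsC -scalerAl mul1r; exact: homogZ.
- rewrite clsD mulrDl; apply: (PD).
  + exact: IHs _ PD Ph _ _ kb.
  + exact: IHt _ PD Ph _ _ kb.
rewrite clsM -mulrA.
apply: (IHt (fun b' => P (cls _ s * b')) _ _ _ _ kb) => [a a' Pa Pa'|l a la].
  by rewrite mulrDr; exact: PD.
exact: IHs _ PD Ph _ _ la.
Qed.

Lemma homog_Theta (b : B) : homog 0 (Theta b).
Proof.
elim/cls_ind: b; elim=> [g|c|s IHs t IHt|s IHs t IHt].
- rewrite /Theta presalg_liftE; case: g.
  + exact: (homogM (homog_gen GXm) (homog_gen GZp)).
  + exact: (homogM (homog_gen GZm) (homog_gen GXp)).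
  + exact: (homogM (homog_gen GZm) (homog_gen GZp)).
- by rewrite /Theta presalg_liftE; apply: homogZ; exact: homog1.
- by rewrite clsD linear_funD; [exact: homogD | exact: Theta_linear].
by rewrite clsM ThetaM -[0]addr0; exact: homogM.
Qed.

(** * The automorphisms rescaling each degree *)

Definition scale_gen r g : A := r ^ adeg g *: ag g.

Section Scaling.
Variables (r : K) (r_neq0 : r != 0).

Lemma expzM_scale k l a b : (r ^ k *: a) * (r ^ l *: b) = r ^ (k + l) *: (a * b).
Proof. by rewrite -scalerAl -scalerAr scalerA expfzDr. Qed.

Fact scale_gen_rel s t :
  Arel p q s t -> eval (scale_gen r) s = eval (scale_gen r) t.
Proof.
have sE c a : c%:A * a = c *: a by rewrite -scalerAl mul1r.
by case=> /=; rewrite ?eval_hornert /= /scale_gen ?sE !expzM_scale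
  ?(A_zz, A_xpzp, A_xpzm, A_xmzp, A_xmzm, A_xpxm, A_xmxp) ?scale1r //
  scalerA scalerA mulrC.
Qed.

Definition scaling : A -> A := presalg_lift scale_gen_rel.

Lemma scaling_linear : linear scaling.
Proof. exact: presalg_lift_linear. Qed.

Lemma scalingM : {morph scaling : a b / a * b}.
Proof. exact: presalg_liftM. Qed.

Lemma scaling1 : scaling 1 = 1.
Proof. exact: presalg_lift1. Qed.

Lemma scaling_degree : degree_scaling r scaling.
Proof.
split=> [|k a]; first exact: scaling_linear.
elim/homog_ind => [|c a' b IHa IHb|w <-].
- by rewrite scaler0 linear_fun0 //; exact: scaling_linear.
- by rewrite scaling_linear IHa IHb scalerDr !scalerA mulrC.
elim: w => [|g w IHw]; first by rewrite !big_nil scaling1 scale1r.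
by rewrite !big_cons scalingM IHw [scaling _]presalg_liftE expzM_scale.
Qed.

(** Degree scalings are only known on homogeneous elements; this uniqueness
    gives them the multiplicativity of the lift [scaling]. *)
Lemma degree_scaling_eq s s' :
  degree_scaling (p := p) (q := q) r s -> degree_scaling r s' -> s =1 s'.
Proof.
move=> [s_lin sr] [s'_lin s'r]; elim/homog_add_ind => [a b IHa IHb|k a ka].
  by rewrite !linear_funD // IHa IHb.
by rewrite (sr k) // (s'r k).
Qed.

Lemma degree_scaling_inv s t :
  degree_scaling (p := p) (q := q) r s -> degree_scaling r^-1 t -> cancel s t.
Proof.
move=> [s_lin sr] [t_lin tr]; elim/homog_add_ind => [a b IHa IHb|k a ka].
  by rewrite !linear_funD // IHa IHb.
rewrite (sr k) // linear_funZ // (tr k) // scalerA exprz_inv.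
by rewrite -expfzDr // subrr scale1r.
Qed.

End Scaling.

Lemma degree_scaling_automorphism r (s : A -> A) :
  r != 0 -> degree_scaling r s -> is_automorphism s.
Proof.
move=> r_neq0 sr; have rV_neq0 : r^-1 != 0 by rewrite invr_eq0.
have sE := degree_scaling_eq sr (scaling_degree r_neq0).
have tr := scaling_degree rV_neq0.
split=> [||a b|]; first by case: sr.
- by rewrite sE scaling1.
- by rewrite !sE scalingM.
exists (scaling rV_neq0); first exact: degree_scaling_inv sr tr.
by apply: degree_scaling_inv rV_neq0 _ _ tr _; rewrite invrK.
Qed.

(** * Skew derivations of A(p;q) *)

Lemma skew_derivation1 (s d : A -> A) :
  s 1 = 1 -> skew_derivation s d -> d 1 = 0.
Proof.
move=> s1 [_ dM]; have := dM 1 1; rewrite s1 !mulr1 mul1r.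
by move/eqP; rewrite -subr_eq0 opprD addNKr oppr_eq0 => /eqP.
Qed.

Section DegreeOfSkewDerivation.
Variables (r : K) (s d : A -> A) (m : int).
Hypotheses (r_neq0 : r != 0) (sr : degree_scaling r s).
Hypotheses (d_skew : skew_derivation s d).
Hypothesis dm : forall g, homog (adeg g + m) (d (ag g)).

Lemma skew_derivation_homog k a : homog k a -> homog (k + m) (d a).
Proof.
have [d_lin dM] := d_skew; have [s_lin _] := sr.
elim/homog_ind => [|c a' b IHa IHb|w <-].
- by rewrite linear_fun0 //; exact: homog0.
- by rewrite d_lin; apply: homogD => //; exact: homogZ.
elim: w => [|g w IHw].
  rewrite !big_nil (skew_derivation1 _ d_skew); first exact: homog0.
  by have [_ ->] := degree_scaling_automorphism r_neq0 sr.
rewrite !big_cons dM (sr.2 _ _ (homog_word w)); apply: homogD.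
  by rewrite addrAC; apply: homogM (dm g) _; apply: homogZ (homog_word w).
by rewrite -addrA; apply: homogM (homog_gen g) IHw.
Qed.

(** In degree k, applying s before d multiplies by r^k, after d by r^(k+m). *)
Lemma skew_derivation_q_skew Q : Q * r ^ m = 1 -> q_skew Q s d.
Proof.
move=> Qrm t st ts a; have [d_lin _] := d_skew; have [s_lin sk] := sr.
apply: (can_inj st); rewrite ts.
move: a; elim/homog_add_ind => [a b IHa IHb|k a ka].
  rewrite (linear_funD s_lin) !(linear_funD d_lin) scalerDr.
  by rewrite (linear_funD s_lin) IHa IHb.
rewrite (sk k) // (sk (k + m)) ?(linear_funZ d_lin) //.
  rewrite scalerA expfzDr //.
  by rewrite -mulrA [_ * Q]mulrC Qrm mulr1.
by apply: homogZ; exact: skew_derivation_homog.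
Qed.

Lemma B_derivation_skew : B_derivation m (d \o Theta (q := q)).
Proof.
have [d_lin dM] := d_skew.
split=> [c a b | b | a b] /=.
- by rewrite Theta_linear d_lin.
- by rewrite -[m]add0r; apply: skew_derivation_homog (homog_Theta b).
by rewrite ThetaM dM (sr.2 _ _ (homog_Theta b)) expr0z scale1r.
Qed.

End DegreeOfSkewDerivation.
End Grading.

(** * Construction of the three skew derivations *)

Section Construction.
Variables (K : fieldType) (p : {poly K}) (q : K).
Hypothesis q_neq0 : q != 0.
Local Notation A := (Apq p q).
Local Notation ag := (ag p q).

Lemma skew_derivation_extend r (d : agen -> A) (s : A -> A) :
    r != 0 -> degree_scaling r s ->
    (forall t u, Arel p q t u ->
       deval ag (scale_gen p q r) d t = deval ag (scale_gen p q r) d u) ->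
  exists D : A -> A, skew_derivation s D /\ forall g, D (ag g) = d g.
Proof.
move=> r_neq0 sr dR; have agR := @A_rel _ p q.
have vR := @scale_gen_rel _ p q _ r_neq0.
exists (presalg_der ag (scale_gen p q r) d (R := Arel p q)); split; last first.
  by move=> g; rewrite (presalg_derE agR vR dR).
split=> [|a b]; first exact: (presalg_der_linear agR vR dR).
have sE := degree_scaling_eq sr (scaling_degree p q r_neq0).
rewrite (presalg_derM agR vR dR) sE; congr (_ + _ * _).
by elim/cls_ind: a => t; rewrite presalg_liftE cls_evalA.
Qed.

Lemma skew_derivationZ (s D : A -> A) c :
  skew_derivation s D -> skew_derivation s (fun a => c *: D a).
Proof.
move=> [D_lin DM]; split=> [k a b | a b].
  by rewrite D_lin scalerDr !scalerA mulrC.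
by rewrite DM scalerDr -scalerAl -scalerAr.
Qed.

Local Notation h f := (horner_alg (zp * zm : A) f).
Local Notation D := (qderiv (q ^+ 2) p).

Let cE c (a : A) : c%:A * a = c *: a.
Proof. by rewrite -scalerAl mul1r. Qed.

Lemma xp_z : xp * (zp * zm) = q ^- 2 *: (zp * zm * xp) :> A.
Proof.
rewrite mulrA A_xpzp -scalerAl -[_ * xp * zm]mulrA A_xpzm -scalerAr scalerA.
by rewrite mulrA -expr2 exprVn.
Qed.

Lemma xm_z : xm * (zp * zm) = q ^+ 2 *: (zp * zm * xm) :> A.
Proof.
rewrite mulrA A_xmzp -scalerAl -[_ * xm * zm]mulrA A_xmzm -scalerAr scalerA.
by rewrite mulrA -expr2.
Qed.

Lemma zp_z : zp * (zp * zm) = zp * zm * zp :> A.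
Proof. by rewrite -[RHS]mulrA A_zz. Qed.

Lemma zm_z : zm * (zp * zm) = zp * zm * zm :> A.
Proof. by rewrite mulrA A_zz. Qed.

Lemma xp_horner f : xp * h f = h (f \Po (q ^- 2 *: 'X)) * xp.
Proof. by rewrite -horner_alg_scale; apply: horner_alg_skew; exact: xp_z. Qed.

Lemma xm_horner f : xm * h f = h (f \Po (q ^+ 2 *: 'X)) * xm.
Proof. by rewrite -horner_alg_scale; apply: horner_alg_skew; exact: xm_z. Qed.

Lemma zp_horner f : zp * h f = h f * zp.
Proof.
rewrite -[in RHS](scale1r (zp * zm)); apply: horner_alg_skew.
by rewrite scale1r zp_z.
Qed.

Lemma zm_horner f : zm * h f = h f * zm.
Proof.
rewrite -[in RHS](scale1r (zp * zm)); apply: horner_alg_skew.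
by rewrite scale1r zm_z.
Qed.

Lemma czE : cz p q = q *: h D.
Proof. by rewrite /cz linearZ /= cE. Qed.

Lemma zp_cz : zp * cz p q = cz p q * zp.
Proof. exact: zp_horner. Qed.

Lemma zm_cz : zm * cz p q = cz p q * zm.
Proof. exact: zm_horner. Qed.

Lemma xmxp_qderiv :
  xm * xp = xp * xm + (q ^+ 2 - 1) *: (h D * (zp * zm)) :> A.
Proof.
rewrite A_xmxp A_xpxm -A_zz horner_alg_scale comp_scaleX_qderiv rmorphD /=.
by rewrite linearZ /= cE rmorphM /= horner_algX.
Qed.

(** The condition for del_- to respect x_- z_- = q z_- x_-, and for del_+ to
    respect x_+ z_+ = q^-1 z_+ x_+; it is the reason for the choice c = q p_{q^2}. *)
Lemma xmxp_cz :
  xm * xp + q^-1 *: (cz p q * (zp * zm)) =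
  xp * xm + q *: (cz p q * (zp * zm)) :> A.
Proof.
rewrite xmxp_qderiv czE -scalerAl !scalerA mulVf // -addrA -scalerDl.
by rewrite subrK expr2.
Qed.

Lemma xp_cz : xp * cz p q = q *: (h (qderiv (q ^- 2) p) * xp).
Proof.
have q2_neq0 : q ^- 2 != 0 by rewrite invr_eq0 expf_neq0.
by rewrite czE -scalerAr xp_horner -(qderivV_comp_scaleX p q2_neq0) invrK.
Qed.

Lemma xm_cz : xm * cz p q = q *: (h (D \Po (q ^+ 2 *: 'X)) * xm).
Proof. by rewrite czE -scalerAr xm_horner. Qed.

(** The values of a twisted derivation on p(z_+ z_-) and p(q^2 z_- z_+), the
    right-hand sides of the relations for x_+ x_- and x_- x_+. Since d is not
    yet known to descend to A(p;q), its agreement on z_+ z_- and z_- z_+ is a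
    hypothesis of the second one. *)
Section ValuesOnRelations.
Variables (r Q : K) (d : agen -> A).
Hypothesis r_neq0 : r != 0.
Local Notation dval := (deval ag (scale_gen p q r) d).
Let dz := d GZp * (r^-1 *: zm) + zp * d GZm.
Hypothesis dz_skew : dz * (zp * zm) = Q *: (zp * zm * dz).

Let sclM (a b : A) : (r *: a) * (r^-1 *: b) = a * b.
Proof. by rewrite -scalerAl -scalerAr scalerA divff // scale1r. Qed.

Lemma deval_xpxm :
  dval (hornert p (Mul (Gen GZp) (Gen GZm))) = h (qderiv Q p) * dz.
Proof. by rewrite (deval_hornert (Q := Q)) //= /scale_gen /= sclM. Qed.

Lemma deval_xmxp :
    d GZm * (r *: zp) + zm * d GZp = dz ->
  dval (hornert p (Mul (Cst (q ^+ 2)) (Mul (Gen GZm) (Gen GZp)))) =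
  q ^+ 2 *: (h (qderiv Q p \Po (q ^+ 2 *: 'X)) * dz).
Proof.
move=> zE; have zrE : (r^-1 *: zm) * (r *: zp) = zp * zm :> A.
  by rewrite A_zz -scalerAl -scalerAr scalerA mulVf // scale1r.
rewrite (deval_hornert (Q := Q)) /= /scale_gen /= ?expr1z ?exprN1 ?cE.
- by rewrite zE mul0r add0r -A_zz horner_alg_scale scalerAr.
- by rewrite zrE A_zz.
rewrite zE mul0r add0r -A_zz -!scalerAl -!scalerAr dz_skew !scalerA.
by rewrite mulrC mulrA.
Qed.

End ValuesOnRelations.

(** On a word of degree k, del_0 is multiplication by alpha [k]_{q^2}. A
    product of two generators is thus an eigenvector whose eigenvalue depends
    only on their degrees, and is zero when these are opposite. *)
Lemma del0_exists s0 alpha : degree_scaling (q ^+ 2) s0 ->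
  exists d, is_del0 (p := p) (q := q) s0 alpha d.
Proof.
have q2_neq0 : q ^+ 2 != 0 by rewrite expf_neq0.
pose e (g : agen) : K := if adeg g == 1 then 1 else - q ^- 2.
pose d0 g : A := e g *: ag g.
(* The eigenvalue of the product of [g] and [g']. *)
pose N g g' := e g * (q ^+ 2) ^ adeg g' + e g'.
have N0 g g' : adeg g = - adeg g' -> N g g' = 0.
  by rewrite /N /e; case: g g' => -[] //= _;
    rewrite ?expr1z ?exprN1 ?mul1r ?mulNr ?mulVf // ?subrr ?addNr.
have NC g g' : N g g' = N g' g.
  have [gg' | gg'] := eqVneq (adeg g) (- adeg g').
    by rewrite !N0 // gg' opprK.
  by congr (_ * _ ^ _ + _); case: g g' gg' => -[].
pose dval := deval ag (scale_gen p q (q ^+ 2)) d0.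
have dM g g' : dval (Mul (Gen g) (Gen g')) = N g g' *: (ag g * ag g').
  by rewrite /dval /= /d0 /scale_gen -scalerAl -!scalerAr scalerA -scalerDl.
have dZ c t : dval (Mul (Cst c) t) = c *: dval t.
  by rewrite /dval /= mul0r add0r cE.
have dz0 : d0 GZp * (q ^- 2 *: zm) + zp * d0 GZm = 0.
  by have := dM GZp GZm; rewrite N0 // scale0r.
have dz0' : d0 GZm * (q ^+ 2 *: zp) + zm * d0 GZp = 0.
  by have := dM GZm GZp; rewrite N0 // scale0r.
move=> s0r; have [|d [d_skew dE]] := skew_derivation_extend (d := d0) q2_neq0 s0r.
  have dz_skew : (d0 GZp * (q ^- 2 *: zm) + zp * d0 GZm) * (zp * zm) =
     1 *: (zp * zm * (d0 GZp * (q ^- 2 *: zm) + zp * d0 GZm)).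
    by rewrite dz0 mulr0 mul0r scaler0.
  rewrite -/dval => _ _ [].
  - by rewrite !dM NC A_zz.
  - by rewrite dZ !dM NC A_xpzp !scalerA mulrC.
  - by rewrite dZ !dM NC A_xpzm !scalerA mulrC.
  - by rewrite dZ !dM NC A_xmzp !scalerA mulrC.
  - by rewrite dZ !dM NC A_xmzm !scalerA mulrC.
  - by rewrite dM N0 // scale0r /dval (deval_xpxm q2_neq0 dz_skew) dz0 mulr0.
  rewrite dM N0 // scale0r /dval (deval_xmxp q2_neq0 dz_skew) dz0 //.
  by rewrite mulr0 scaler0.
exists (fun a => alpha *: d a); split; first exact: skew_derivationZ.
by rewrite !dE /d0 /e /= !scale1r !scalerA [alpha * _]mulrC.
Qed.

(** Here dz = z_+ x_+, and moving x_+ past z produces Q = q^-2. *)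
Lemma delm_exists sm alpha : degree_scaling q sm ->
  exists d, is_delm (p := p) (q := q) sm alpha d.
Proof.
pose d0 (g : agen) : A :=
  match g with GXm => cz p q * zp | GZm => xp | _ => 0 end.
have dz0 : d0 GZp * (q^-1 *: zm) + zp * d0 GZm = zp * xp.
  by rewrite /= mul0r add0r.
have dz0' : d0 GZm * (q *: zp) + zm * d0 GZp = zp * xp.
  by rewrite /= mulr0 addr0 -scalerAr A_xpzp scalerA divff // scale1r.
have dz_skew : (d0 GZp * (q^-1 *: zm) + zp * d0 GZm) * (zp * zm) =
   q ^- 2 *: (zp * zm * (d0 GZp * (q^-1 *: zm) + zp * d0 GZm)).
  by rewrite dz0 -mulrA xp_z -scalerAr [zp * (_ * xp)]mulrA zp_z -mulrA.
move=> smr; have [|d [d_skew dE]] := skew_derivation_extend (d := d0) q_neq0 smr.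
  move=> _ _ [].
  - by rewrite /= [LHS]dz0 [RHS]dz0'.
  - by rewrite /= !(mul0r, mulr0, addr0).
  - rewrite /= /scale_gen /= expr1z cE !(mul0r, mulr0, add0r, addr0).
    by rewrite -scalerAr scalerA mulVf // scale1r.
  - rewrite /= /scale_gen /= expr1z cE !(mul0r, mulr0, add0r, addr0).
    by rewrite -scalerAr mulrA zp_cz.
  - rewrite /= /scale_gen /= ?expr1z ?exprN1 cE !(mul0r, mulr0, add0r, addr0).
    rewrite -!scalerAr -mulrA addrC xmxp_cz scalerDr scalerA divff // scale1r.
    by rewrite [zm * _]mulrA zm_cz -mulrA A_zz.
  - rewrite (deval_xpxm q_neq0 dz_skew) dz0 /= mul0r add0r.
    rewrite mulrA xp_cz -scalerAl -mulrA A_xpzp -scalerAr scalerA divff //.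
    by rewrite scale1r.
  - rewrite (deval_xmxp q_neq0 dz_skew) dz0 //= /scale_gen /= mulr0 addr0 expr1z.
    rewrite qderivV_comp_scaleX ?expf_neq0 // -scalerAr czE -!scalerAl scalerA.
    by rewrite -mulrA.
exists (fun a => alpha *: d a); split; first exact: skew_derivationZ.
by rewrite !dE /= scaler0.
Qed.

(** Here dz = z_- x_-, and moving x_- past z produces Q = q^2. *)
Lemma delp_exists sp alpha : degree_scaling q sp ->
  exists d, is_delp (p := p) (q := q) sp alpha d.
Proof.
pose d0 (g : agen) : A :=
  match g with GXp => cz p q * zm | GZp => xm | _ => 0 end.
have dz0 : d0 GZp * (q^-1 *: zm) + zp * d0 GZm = zm * xm.
  by rewrite /= mulr0 addr0 -scalerAr A_xmzm scalerA mulVf // scale1r.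
have dz0' : d0 GZm * (q *: zp) + zm * d0 GZp = zm * xm.
  by rewrite /= mul0r add0r.
have dz_skew : (d0 GZp * (q^-1 *: zm) + zp * d0 GZm) * (zp * zm) =
   q ^+ 2 *: (zp * zm * (d0 GZp * (q^-1 *: zm) + zp * d0 GZm)).
  by rewrite dz0 -mulrA xm_z -scalerAr [zm * (_ * xm)]mulrA zm_z -mulrA.
move=> spr; have [|d [d_skew dE]] := skew_derivation_extend (d := d0) q_neq0 spr.
  move=> _ _ [].
  - by rewrite /= [LHS]dz0 [RHS]dz0'.
  - rewrite /= /scale_gen /= expr1z cE !(mul0r, mulr0, add0r, addr0).
    rewrite -!scalerAr -mulrA -A_zz addrC -xmxp_cz.
    rewrite scalerDr scalerA mulVf // scale1r [zp * (_ * zm)]mulrA zp_cz.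
    by rewrite -mulrA.
  - rewrite /= /scale_gen /= ?expr1z ?exprN1 cE !(mul0r, mulr0, add0r, addr0).
    by rewrite -scalerAr mulrA zm_cz.
  - rewrite /= /scale_gen /= ?expr1z ?exprN1 cE !(mul0r, mulr0, add0r, addr0).
    by rewrite -scalerAr scalerA divff // scale1r.
  - by rewrite /= !(mul0r, mulr0, addr0).
  - rewrite (deval_xpxm q_neq0 dz_skew) dz0 /= /scale_gen /= mulr0 addr0.
    by rewrite exprN1 -scalerAr czE -!scalerAl scalerA mulVf // scale1r mulrA.
  - rewrite (deval_xmxp q_neq0 dz_skew) dz0 //= mul0r add0r.
    rewrite mulrA xm_cz -scalerAl -mulrA A_xmzm -scalerAr scalerA.
    by rewrite -expr2.
exists (fun a => alpha *: d a); split; first exact: skew_derivationZ.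
by rewrite !dE /= scaler0.
Qed.

End Construction.

(** * Degrees and restriction to B(p;q) *)

Section Restriction.
Variables (K : fieldType) (p : {poly K}) (q : K).

Lemma B_derivation_eq0 k (delta : Bpq p q -> Apq p q) :
    B_derivation k delta -> (forall g, delta (bg p q g) = 0) ->
  forall b, delta b = 0.
Proof.
move=> [delta_lin _ deltaM] delta_g.
have delta1 : delta 1 = 0.
  have := deltaM 1 1; rewrite Theta1 !mulr1 mul1r => /eqP.
  by rewrite -subr_eq0 opprD addNKr oppr_eq0 => /eqP.
elim/cls_ind; elim=> [g|c|s IHs t IHt|s IHs t IHt].
- exact: delta_g.
- by rewrite clsC (linear_funZ delta_lin) delta1 scaler0.
- by rewrite clsD (linear_funD delta_lin) IHs IHt addr0.
by rewrite clsM deltaM IHs IHt mul0r mulr0 addr0.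
Qed.

Lemma del0_gen_homog s0 alpha d : is_del0 (p := p) (q := q) s0 alpha d ->
  forall g, homog (adeg g + 0) (d (ag p q g)).
Proof.
by move=> [_ [dxp dxm dzp dzm]] g; rewrite addr0; case: g;
  rewrite ?(dxp, dxm, dzp, dzm); apply: homogZ; exact: homog_gen.
Qed.

Lemma cz_homog : homog 0 (cz p q).
Proof.
apply: homog_horner_alg.
exact: (homogM (homog_gen p q GZp) (homog_gen p q GZm)).
Qed.

Lemma delm_gen_homog sm alpha d : is_delm (p := p) (q := q) sm alpha d ->
  forall g, homog (adeg g + 2) (d (ag p q g)).
Proof.
move=> [_ [dxp dzp dxm dzm]] [].
- by rewrite [d _]dxp; exact: homog0.
- by rewrite [d _]dxm; apply: homogZ; exact: (homogM cz_homog (homog_gen p q GZp)).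
- by rewrite [d _]dzp; exact: homog0.
by rewrite [d _]dzm; apply: homogZ; exact: (homog_gen p q GXp).
Qed.

Lemma delp_gen_homog sp alpha d : is_delp (p := p) (q := q) sp alpha d ->
  forall g, homog (adeg g + - 2) (d (ag p q g)).
Proof.
move=> [_ [dxm dzm dxp dzp]] [].
- by rewrite [d _]dxp; apply: homogZ; exact: (homogM cz_homog (homog_gen p q GZm)).
- by rewrite [d _]dxm; exact: homog0.
- by rewrite [d _]dzp; apply: homogZ; exact: (homog_gen p q GXm).
by rewrite [d _]dzm; exact: homog0.
Qed.

End Restriction.

Theorem theorem3p1 (K : fieldType) (charK : [pchar K] =i pred0)
    (p : {poly K}) (q : K) (q_neq0 : q != 0) :
  (exists sp sm s0 : Apq p q -> Apq p q,
     [/\ degree_scaling q sp, degree_scaling q sm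
       & degree_scaling (q ^+ 2) s0]) /\
  (forall sp sm s0 : Apq p q -> Apq p q,
     degree_scaling q sp -> degree_scaling q sm ->
     degree_scaling (q ^+ 2) s0 ->
     [/\ (* (1) *)
         [/\ is_automorphism sp, is_automorphism sm & is_automorphism s0],
         (* (2) *)
         forall alpha0 : K, exists d0, is_del0 s0 alpha0 d0,
         (* (3) *)
         forall alpham : K, exists dm, is_delm sm alpham dm,
         (* (4) *)
         forall alphap : K, exists dp, is_delp sp alphap dp
       & forall (alpha0 alpham alphap : K) (d0 dm dp : Apq p q -> Apq p q),
         is_del0 s0 alpha0 d0 -> is_delm sm alpham dm ->
         is_delp sp alphap dp ->
         (* (5) *)
         [/\ q_skew 1 s0 d0, q_skew (q ^+ 2) sp dp & q_skew (q ^- 2) sm dm] /\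
         (* (6) *)
         [/\ B_derivation (- 2) (dp \o @Theta K p q),
             B_derivation 2 (dm \o @Theta K p q)
           & forall b : Bpq p q, d0 (Theta b) = 0]]).
Proof.
have q2_neq0 : q ^+ 2 != 0 by rewrite expf_neq0.
split.
  exists (scaling q_neq0), (scaling q_neq0), (scaling q2_neq0).
  by split; exact: scaling_degree.
move=> sp sm s0 spq smq s0q; split.
- by split; [exact: degree_scaling_automorphism spq
           | exact: degree_scaling_automorphism smq
           | exact: degree_scaling_automorphism s0q].
- by move=> alpha0; exact: del0_exists.
- by move=> alpham; exact: delm_exists.
- by move=> alphap; exact: delp_exists.
move=> alpha0 alpham alphap d0 dm dp del0 delm delp.
have h0 := del0_gen_homog del0.
have hm := delm_gen_homog delm.
have hp := delp_gen_homog delp.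
have [d0_skew [d0xp d0xm d0zp d0zm]] := del0.
have [dm_skew _] := delm; have [dp_skew _] := delp.
have [_ d0M] := d0_skew; have [_ s0E] := s0q.
split; split.
- by apply: skew_derivation_q_skew q2_neq0 s0q d0_skew h0 _ _; rewrite mul1r.
- by apply: skew_derivation_q_skew q_neq0 spq dp_skew hp _ _; exact: mulfV.
- by apply: skew_derivation_q_skew q_neq0 smq dm_skew hm _ _; exact: mulVf.
- exact: B_derivation_skew q_neq0 spq dp_skew hp.
- exact: B_derivation_skew q_neq0 smq dm_skew hm.
apply: B_derivation_eq0 (B_derivation_skew q2_neq0 s0q d0_skew h0) _ => -[] /=.
- rewrite Theta_x d0M d0xm d0zp (s0E 1) ?expr1z; last exact: (homog_gen p q GZp).
  rewrite -scalerAl -!scalerAr scalerA -scalerDl mulrAC mulNr mulVf //.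
  by rewrite mulN1r addNr scale0r.
- rewrite Theta_y d0M d0zm d0xp (s0E 1) ?expr1z; last exact: (homog_gen p q GXp).
  rewrite -scalerAl -!scalerAr scalerA -scalerDl mulrAC mulNr mulVf //.
  by rewrite mulN1r addNr scale0r.
rewrite Theta_z d0M d0zm d0zp (s0E 1) ?expr1z; last exact: (homog_gen p q GZp).
rewrite -scalerAl -!scalerAr scalerA -scalerDl mulrAC mulNr mulVf //.
by rewrite mulN1r addNr scale0r.
Qed.
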